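(* Let $q$ be a prime power, let $\xi\in\mathbb F_{q^2}\setminus\mathbb F_q$, and let $k\ge0$ be an integer with $k\le q+1$. Let $W$ be a $\mathrm{GL}_2(\mathbb F_q)$-invariant subspace of $\mathbb F_q[X,Y]_k$. Then $$\widetilde{\mathcal B}_W=\{\,T\subseteq U_{q+1}:\ |T|=k,\ G_T(U,V)\in\widetilde W\,\}.$$ In particular, if $\mathcal B_W\neq\varnothing$, then $(U_{q+1},\widetilde{\mathcal B}_W)$ is a $3$-$(q+1,k,\lambda)$ design for some $\lambda$.
   Context: $\mathbb F_q[X,Y]_k$ is the $\mathbb F_q$-space of homogeneous polynomials of degree $k$ in $X,Y$ over $\mathbb F_q$ (including $0$). The group $\mathrm{GL}_2(\mathbb F_q)$ acts on it by $(g\cdot f)(X,Y)=f(dX-bY,-cX+aY)$ for $g=\begin{pmatrix}a&b\\c&d\end{pmatrix}$; an $\mathbb F_q$-subspace $W$ is $\mathrm{GL}_2(\mathbb F_q)$-invariant if $g\cdot f\in W$ for all $g\in\mathrm{GL}_2(\mathbb F_q)$, $f\in W$. $\mathbb P^1(\mathbb F_q)=\mathbb F_q\cup\{\infty\}$. For a $k$-subset $S\subseteq\mathbb P^1(\mathbb F_q)$, $F_S(X,Y)=\prod_{t\in S}(X-tY)$, where the factor for $t=\infty$ is taken to be $Y$. The block set is $\mathcal B_W=\{S\subseteq\mathbb P^1(\mathbb F_q): |S|=k,\ F_S\in W\}$. $U_{q+1}=\{u\in\mathbb F_{q^2}^\times:u^{q+1}=1\}$. The Cayley transform is the bijection $\kappa:\mathbb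 P^1(\mathbb F_q)\to U_{q+1}$, $\kappa(x)=\frac{x-\xi}{x-\xi^q}$ for $x\in\mathbb F_q$, $\kappa(\infty)=1$. Set $\widetilde{\mathcal B}_W=\{\kappa(S):S\in\mathcal B_W\}$. The transformed subspace is $$\widetilde W=\mathrm{span}_{\mathbb F_{q^2}}\{f(\xi^qU-\xi V,\,U-V):f\in W\}\subseteq\mathbb F_{q^2}[U,V]_k.$$ For a $k$-subset $T\subseteq U_{q+1}$, $G_T(U,V)=\prod_{u\in T}(U-uV)\in\mathbb F_{q^2}[U,V]_k$. A $t$-$(v,k,\lambda)$ design is a pair $(P,\mathcal B)$ with $P$ a finite set, $|P|=v$, and $\mathcal B$ a set of $k$-subsets of $P$ such that every $t$-subset of $P$ is contained in exactly $\lambda$ members of $\mathcal B$. *)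

(* Defs.v *)
From mathcomp Require Import all_boot all_fingroup all_algebra.
From mathcomp Require Export mpoly.

Set Implicit Arguments.
Unset Strict Implicit.
Unset Printing Implicit Defensive.

Import GRing.Theory.
Local Open Scope ring_scope.

Section Polynomials.

Variable R : comNzRingType.

Definition X1 : {mpoly R[2]} := 'X_(0 : 'I_2).
Definition X2 : {mpoly R[2]} := 'X_(1 : 'I_2).

Definition subst2 (f p1 p2 : {mpoly R[2]}) : {mpoly R[2]} :=
  f \mPo [tuple p1; p2].

End Polynomials.

Arguments X1 {R}.
Arguments X2 {R}.

Section Span.

Variables (R : pzRingType) (V : lmodType R).

Definition in_span (A : V -> Prop) (v : V) : Prop :=
  exists (n : nat) (c : 'I_n -> R) (a : 'I_n -> V),
    (forall i, A (a i)) /\ v = \sum_(i < n) c i *: a i.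

End Span.

Definition is_design (T : finType) (t v k lambda : nat)
    (P : {set T}) (B : {set {set T}}) : Prop :=
  [/\ #|P| = v,
      forall S, S \in B -> S \subset P /\ #|S| = k
    & forall A : {set T}, A \subset P -> #|A| = t ->
        #|[set S in B | A \subset S]| = lambda].

Section BaseField.

Variable F : finFieldType.

Definition gl2_act (g : {'GL_2[F]}) (f : {mpoly F[2]}) : {mpoly F[2]} :=
  let a := GLval g 0 0 in let b := GLval g 0 1 in
  let c := GLval g 1 0 in let d := GLval g 1 1 in
  subst2 f (d *: X1 - b *: X2) (- c *: X1 + a *: X2).

Definition gl2_invariant (W : {pred {mpoly F[2]}}) : Prop :=
  forall (g : {'GL_2[F]}) f, f \in W -> gl2_act g f \in W.

Definition is_form_subspace (k : nat) (W : {pred {mpoly F[2]}}) : Prop :=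
  GRing.submod_closed W /\ {subset W <= k.-homog}.

(* The projective line over F is [option F], with [None] the point at
   infinity. *)
Definition linear_factor (t : option F) : {mpoly F[2]} :=
  if t is Some x then X1 - x *: X2 else X2.

Definition form_of_set (S : {set option F}) : {mpoly F[2]} :=
  \prod_(t in S) linear_factor t.

Definition blocks (k : nat) (W : {pred {mpoly F[2]}}) : {set {set option F}} :=
  [set S : {set option F} | (#|S| == k) && (form_of_set S \in W)].

End BaseField.

Section QuadraticExtension.

(* [iota] embeds F_q in L = F_{q^2}; the degree and the condition that
   [xi] lies outside F_q are hypotheses of the results, not of the definitions. *)
Variables (F L : finFieldType) (iota : {rmorphism F -> L}) (xi : L).

Definition unit_circle : {set L} :=
  [set u : L | (u != 0) && (u ^+ (#|F| + 1) == 1)].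

Definition cayley (t : option F) : L :=
  if t is Some x then (iota x - xi) / (iota x - xi ^+ #|F|) else 1.

Definition cayley_blocks (k : nat) (W : {pred {mpoly F[2]}}) :
    {set {set L}} :=
  [set cayley @: S | S : {set option F} in blocks k W].

Definition cayley_subst (f : {mpoly F[2]}) : {mpoly L[2]} :=
  subst2 (map_mpoly iota f) (xi ^+ #|F| *: X1 - xi *: X2) (X1 - X2).

(* Membership in the L-span of the f(xi^q U - xi V, U - V), f in W. *)
Definition in_transformed (W : {pred {mpoly F[2]}}) : {mpoly L[2]} -> Prop :=
  in_span (fun h => exists2 f, f \in W & h = cayley_subst f).

Definition circle_form (T : {set L}) : {mpoly L[2]} :=
  \prod_(u in T) (X1 - u *: X2).

End QuadraticExtension.

Arguments unit_circle F L : clear implicits.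

(* Main.v *)
(* The Cayley substitution is invertible over L and carries each linear form
   X - tY to a nonzero multiple of U - kappa(t)V, so F_S goes to a multiple of
   G_{kappa(S)}; kappa is a bijection onto the unit circle because it is
   injective and u^(q+1) = 1 has at most q+1 roots.  Hence G_{kappa(S)} lies in
   the transformed space iff F_S lies in the L-span of W, and since 1, xi is an
   F-basis of L, comparing coefficients shows that F_S then lies in W itself.
   For the design property, GL_2(F) permutes the blocks through its action on
   the projective line; affine maps and t |-> 1/t already move any three points
   to 0, 1, infinity, so all triples lie in equally many blocks. *)

Require Import Defs.
From mathcomp Require Import all_boot all_fingroup all_algebra.
From mathcomp Require Import finfield ring.

Set Implicit Arguments.
Unset Strict Implicit.
Unset Printing Implicit Defensive.

Import GRing.Theory.
Local Open Scope ring_scope.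

(** Both [gl2_act] and the Cayley substitution match linear factors only up to a nonzero scalar;
    this passes that on to the products [form_of_set] and [circle_form]. *)
Lemma prod_scaled (K : idomainType) (A : algType K) (I : finType)
    (S : {set I}) (a b : I -> A) :
  (forall i, exists2 c : K, c != 0 & a i = c *: b i) ->
  exists2 c : K, c != 0 & \prod_(i in S) a i = c *: \prod_(i in S) b i.
Proof.
move=> ab; elim/big_rec2: _ => [|i y z _ [c c0 ->]].
  by exists 1; rewrite ?oner_eq0 ?scale1r.
have [d d0 ->] := ab i; exists (d * c); first by rewrite mulf_neq0.
by rewrite -scalerAl -scalerAr scalerA.
Qed.

(** * Substitution in binary polynomials *)

Section Substitution.
Variable R : comNzRingType.
Implicit Types (f g p : {mpoly R[2]}).

Lemma subst2_X1 p1 p2 : subst2 X1 p1 p2 = p1 :> {mpoly R[2]}.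
Proof. by rewrite /subst2 comp_mpolyXU. Qed.

Lemma subst2_X2 p1 p2 : subst2 X2 p1 p2 = p2 :> {mpoly R[2]}.
Proof. by rewrite /subst2 comp_mpolyXU. Qed.

Lemma subst2B f g p1 p2 : subst2 (f - g) p1 p2 = subst2 f p1 p2 - subst2 g p1 p2.
Proof. exact: raddfB. Qed.

Lemma subst2Z c f p1 p2 : subst2 (c *: f) p1 p2 = c *: subst2 f p1 p2.
Proof. exact: comp_mpolyZ. Qed.

Lemma subst2_sum (I : Type) (r : seq I) (P : pred I) (f : I -> {mpoly R[2]}) p1 p2 :
  subst2 (\sum_(i <- r | P i) f i) p1 p2 = \sum_(i <- r | P i) subst2 (f i) p1 p2.
Proof. exact: raddf_sum. Qed.

Lemma subst2_prod (I : Type) (r : seq I) (P : pred I) (f : I -> {mpoly R[2]}) p1 p2 :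
  subst2 (\prod_(i <- r | P i) f i) p1 p2 = \prod_(i <- r | P i) subst2 (f i) p1 p2.
Proof. exact: rmorph_prod. Qed.

Lemma subst2_id f : subst2 f X1 X2 = f.
Proof.
rewrite -[RHS]comp_mpoly_id /subst2; congr (_ \mPo _).
apply: eq_from_tnth => i; rewrite tnth_mktuple.
by case: i => [[|[|//]] /= lt_i]; rewrite (tnth_nth 0) /=; congr ('X_ _); apply: val_inj.
Qed.

Lemma subst2_comp f p1 p2 r1 r2 :
  subst2 (subst2 f p1 p2) r1 r2 = subst2 f (subst2 p1 r1 r2) (subst2 p2 r1 r2).
Proof.
rewrite /subst2 !(comp_mpolyE f) raddf_sum /=; apply: eq_bigr => m _.
rewrite comp_mpolyZ rmorph_prod /=; congr (_ *: _).
apply: eq_bigr => i _; rewrite rmorphXn /=; congr (_ ^+ _).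
by case: i => [[|[|//]] /= lt_i]; rewrite !(tnth_nth 0).
Qed.

End Substitution.

(** * Moebius maps of the projective line acting on blocks *)

Section Moebius.
Variables (F : finFieldType) (k : nat) (W : {pred {mpoly F[2]}}).
Hypotheses (W_sub : GRing.submod_closed W) (W_inv : gl2_invariant W).

Lemma submod_closed_scale c f : f \in W -> c *: f \in W.
Proof. by case: W_sub => W0 Wl Wf; rewrite -[_ *: _]addr0; apply: Wl. Qed.

(** One inclusion is enough: there are finitely many blocks, so an injective [m] that sends blocks
    to blocks permutes them. *)
Definition block_perm (m : option F -> option F) : Prop :=
  injective m /\ forall S, S \in blocks k W -> m @: S \in blocks k W.

Lemma block_perm_comp m1 m2 :
  block_perm m1 -> block_perm m2 -> block_perm (m1 \o m2).
Proof.
move=> [i1 b1] [i2 b2]; split; first exact: inj_comp.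
by move=> S bS; rewrite imset_comp; apply: b1; apply: b2.
Qed.

Lemma block_perm_gl2 (g : {'GL_2[F]}) (m : option F -> option F) :
    injective m ->
    (forall t, exists2 c, c != 0 &
       gl2_act g (linear_factor t) = c *: linear_factor (m t)) ->
  block_perm m.
Proof.
move=> m_inj gm; split=> // S; rewrite !inE => /andP[/eqP cS SW].
rewrite card_imset // cS eqxx /=.
have := W_inv g SW; rewrite /gl2_act /form_of_set subst2_prod.
have [c c0 ->] := prod_scaled S gm.
move/(submod_closed_scale c^-1); rewrite scalerA mulVf // scale1r.
by rewrite big_imset //= => ? ? _ _; apply: m_inj.
Qed.

Lemma gl2_of_entries (a b c d : F) : a * d - b * c != 0 ->
  exists g : {'GL_2[F]}, [/\ GLval g 0 0 = a, GLval g 0 1 = b,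
    GLval g 1 0 = c & GLval g 1 1 = d].
Proof.
move=> D0; pose M : 'M[F]_2 := \matrix_(i, j)
  if i == 0 then (if j == 0 then a else b) else (if j == 0 then c else d).
have uM : M \is a GRing.unit.
  rewrite unitmxE unitfE (expand_det_row M 0) !big_ord_recl big_ord0.
  rewrite /cofactor !det_mx11 !mxE /=.
  by rewrite addr0 expr0 mul1r expr1 mulN1r mulrN.
by exists (FinRing.Unit uM); rewrite /= !mxE.
Qed.

Lemma block_perm_affine a b : a != 0 ->
  block_perm (omap (fun x => a * x + b)).
Proof.
(* This matrix acts by X -> X - bY, Y -> aY, so X - xY goes to X - (ax + b)Y. *)
move=> a0; have [|g [g1 g2 g3 g4]] := @gl2_of_entries a b 0 1.
  by rewrite mulr0 mulr1 subr0.
apply: (@block_perm_gl2 g) => [|t].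
  apply: inj_omap => x y /addIr; exact: mulfI.
rewrite /gl2_act g1 g2 g3 g4 scale1r oppr0 scale0r add0r; case: t => [x|] /=.
  exists 1; rewrite ?oner_eq0 // subst2B subst2Z subst2_X1 subst2_X2 scale1r.
  by rewrite scalerA -addrA -opprD -scalerDl addrC [x * a]mulrC [b + _]addrC addrC.
by exists a; rewrite // subst2_X2.
Qed.

Definition projective_inv (t : option F) : option F :=
  if t is Some x then if x == 0 then None else Some x^-1 else Some 0.

Lemma projective_invK : involutive projective_inv.
Proof.
case=> [x|] /=; last by rewrite eqxx.
by case: eqVneq => [->//|x0] /=; rewrite invr_eq0 (negPf x0) invrK.
Qed.

Lemma block_perm_inv : block_perm projective_inv.
Proof.
(* The swap acts by X -> -Y, Y -> -X. For x != 0 it sends X - xY to x(X - Y/x); the factors at 0 and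
   infinity are exchanged with scalar -1. *)
have [|g [g1 g2 g3 g4]] := @gl2_of_entries 0 1 1 0.
  by rewrite mulr0 mul1r sub0r oppr_eq0 oner_eq0.
apply: (@block_perm_gl2 g) => [|t]; first exact: inv_inj projective_invK.
rewrite /gl2_act g1 g2 g3 g4 !scale0r scale1r scaleN1r addr0 sub0r.
case: t => [x|] /=; last first.
  by exists (-1); rewrite ?oppr_eq0 ?oner_eq0 // subst2_X2 scale0r subr0 scaleN1r.
rewrite subst2B subst2Z subst2_X1 subst2_X2 scalerN opprK.
case: eqVneq => [->|x0] /=.
  by exists (-1); rewrite ?oppr_eq0 ?oner_eq0 // scale0r addr0 scaleN1r.
by exists x; rewrite // scalerBr scalerA mulfV // scale1r addrC.
Qed.

Lemma block_perm_3transitive (A : {set option F}) : #|A| = 3%N ->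
  exists2 m, block_perm m & m @: A = [set Some 0; Some 1; None].
Proof.
move=> A3.
have [A0|[a aA]] := set_0Vmem A; first by rewrite A0 cards0 in A3.
have /eqP/cards2P[b [c [bc Ea]]] : #|A :\ a| = 2%N.
  by move: A3; rewrite (cardsD1 a) aA => -[].
have {A3} -> : A = [set b; c; a] by rewrite -(setD1K aA) Ea setUC.
have [ab ac] : b != a /\ c != a.
  have : b \in A :\ a by rewrite Ea !inE eqxx.
  have : c \in A :\ a by rewrite Ea !inE eqxx orbT.
  by rewrite !inE => /andP[-> _] /andP[-> _].
(* First send [a] to infinity, by t -> 1/(t - x) when [a] is a finite point x. *)
have [m m_blk ma] : exists2 m, block_perm m & m a = None.
  case: a {aA Ea ab ac} => [x|]; last first.
    exists id => //; split=> // S; by rewrite imset_id.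
  exists (projective_inv \o omap (fun y => 1 * y - x)).
    apply: block_perm_comp; first exact: block_perm_inv.
    by apply: block_perm_affine; rewrite oner_eq0.
  by rewrite /= mul1r subrr eqxx.
have m_inj : injective m by case: m_blk.
have [mb mc mbc] : [/\ m b != None, m c != None & m b != m c].
  by rewrite -ma !(inj_eq m_inj).
case Eb : (m b) mb mbc => [x|//] _; case Ec : (m c) mc => [y|//] _ xy.
have xy0 : y - x != 0 by rewrite subr_eq0; apply: contraNneq xy => ->.
(* The affine map z -> (z - x)/(y - x) takes x to 0 and y to 1, and [omap] fixes infinity. *)
pose n := omap (fun z : F => (y - x)^-1 * z + - ((y - x)^-1 * x)).
exists (n \o m).
  by apply: block_perm_comp => //; apply: block_perm_affine; rewrite invr_eq0.
rewrite !imsetU !imset_set1 /= ma Eb Ec /= subrr -mulrBr mulVf //.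
Qed.

(** The map S -> m(S) is injective from the finite block set to itself, hence bijective, and it
    preserves and reflects containment of [A]. *)
Lemma card_blocks_above_perm m (A : {set option F}) : block_perm m ->
  #|[set S in blocks k W | A \subset S]| =
  #|[set S in blocks k W | m @: A \subset S]|.
Proof.
move=> [m_inj m_blk].
have mS_inj : injective (fun S : {set option F} => m @: S) by exact: imset_inj.
have im_blk : [set m @: S | S : {set option F} in blocks k W] = blocks k W.
  apply/eqP; rewrite eqEcard card_imset // leqnn andbT.
  by apply/subsetP => _ /imsetP[S /m_blk ? ->].
rewrite -[LHS](card_imset _ mS_inj); congr #|pred_of_set _|; apply/setP => T.
rewrite [RHS]inE; apply/imsetP/andP => [[S + ->]|].
  by rewrite inE => /andP[/m_blk ? AS]; rewrite imsetS.
rewrite -{1}im_blk => -[/imsetP[S bS ->] AS]; exists S => //.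
apply/setIdP; split=> //; apply/subsetP => x xA.
have /imsetP[y yS /m_inj -> //] : m x \in m @: S.
by apply: (subsetP AS); apply: imset_f.
Qed.

End Moebius.

(** * Descent of linear combinations from L to F *)

Section Descent.
Variables (F L : finFieldType) (iota : {rmorphism F -> L}) (xi : L).
Hypothesis (cardL : #|L| = (#|F| ^ 2)%N) (xi_notin : xi \notin codom iota).

(** The map (a, b) -> a + b xi is injective, since otherwise xi would be a quotient of elements of
    F; it is bijective because both sides have q^2 elements. *)
Lemma quadratic_coords :
  exists g : L -> F * F, forall z, z = iota (g z).1 + iota (g z).2 * xi.
Proof.
pose f (p : F * F) := iota p.1 + iota p.2 * xi.
have f_inj : injective f.
  move=> [a b] [c d]; rewrite /f /= => eq.
  have eq2 : iota (b - d) * xi = iota (c - a).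
    rewrite !rmorphB mulrBl -[_ * xi](addKr (iota a)) eq; ring.
  have bd : b = d.
    apply/eqP; rewrite -subr_eq0; apply: contraNT xi_notin => bd0.
    apply/codomP; exists ((b - d)^-1 * (c - a)).
    by rewrite rmorphM fmorphV -eq2 mulKf // fmorph_eq0.
  by move: eq; rewrite bd => /addIr/fmorph_inj ->.
have [|g _ gK] := inj_card_bij f_inj; last by exists g => z; rewrite -[LHS]gK.
by rewrite cardL card_prod expnS expn1.
Qed.

Lemma span_descent (W : {pred {mpoly F[2]}}) (f : {mpoly F[2]}) (n : nat)
    (c : 'I_n -> L) (h : 'I_n -> {mpoly F[2]}) :
    GRing.submod_closed W -> (forall i, h i \in W) ->
    map_mpoly iota f = \sum_(i < n) c i *: map_mpoly iota (h i) ->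
  f \in W.
Proof.
move=> [W0 Wl] hW E; have [g gE] := quadratic_coords.
suff -> : f = \sum_(i < n) (g (c i)).1 *: h i.
  by elim/big_rec: _ => // i x _ xW; apply: Wl.
apply/mpolyP => m; have /(congr1 (mcoeff m)) := E.
rewrite mcoeff_map_mpoly !raddf_sum /=.
(* Splitting each [c i] in the basis 1, xi turns the equation of m-th coefficients into f_m = s + t
   xi with s and t in F. *)
under eq_bigr do rewrite mcoeffZ mcoeff_map_mpoly [c _]gE mulrDl mulrAC -!rmorphM.
rewrite big_split -mulr_suml -!rmorph_sum /= => Em.
under eq_bigr do rewrite mcoeffZ.
set s := \sum_(i < n) _ in Em *; set t := \sum_(i < n) _ in Em.
have [t0|t0] := eqVneq t 0.
  by move: Em; rewrite t0 rmorph0 mul0r addr0 => /fmorph_inj.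
(* If t were nonzero, xi = (f_m - s)/t would lie in F. *)
case/negP: xi_notin; apply/codomP; exists ((f@_m - s) / t).
by rewrite fmorph_div rmorphB Em addrAC subrr add0r mulrAC mulfV ?mul1r ?fmorph_eq0.
Qed.

End Descent.

(** * The Cayley transform and its linear substitution *)

Section Cayley.
Variables (F L : finFieldType) (iota : {rmorphism F -> L}) (xi : L).
Hypothesis (cardL : #|L| = (#|F| ^ 2)%N) (xi_notin : xi \notin codom iota).
Let xiq := xi ^+ #|F|.

Lemma frobeniusB : {morph (fun x : L => x ^+ #|F|) : x y / x - y}.
Proof.
have [p p_pr pF] := finPcharP F; have pL : p \in [pchar L].
  by rewrite (fmorph_pchar iota).
have pq : [pchar L].-nat #|F|.
  rewrite (eq_pnat _ (pcharf_eq pL)) -cardsT; exact: (pprimeChar_pgroup pF).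
by move=> x y; rewrite exprDn_pchar // exprNn_pchar.
Qed.

Lemma frobenius_iota x : iota x ^+ #|F| = iota x.
Proof. by rewrite -rmorphXn expf_card. Qed.

Lemma conjK : xiq ^+ #|F| = xi.
Proof. by rewrite -exprM mulnn -cardL expf_card. Qed.

Lemma sub_xi_neq0 x : iota x - xi != 0.
Proof.
by rewrite subr_eq0; apply: contraNneq xi_notin => <-; apply: codom_f.
Qed.

(** If xi^q were in F, Frobenius would fix it, while [conjK] says that Frobenius sends it to xi. *)
Lemma sub_conj_neq0 x : iota x - xiq != 0.
Proof.
rewrite subr_eq0; apply: contraNneq xi_notin => E.
by rewrite -conjK -E frobenius_iota codom_f.
Qed.

(* Otherwise X^q - X would have xi as a root besides the q elements of F. *)
Lemma conj_neq : xiq != xi.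
Proof.
pose g (t : option F) := if t is Some x then iota x else xi.
apply/eqP => E.
have g_inj : injective g.
  move=> [x|] [y|] //= => [/fmorph_inj->//|/eqP|/esym/eqP].
  - by rewrite -subr_eq0 (negPf (sub_xi_neq0 _)).
  - by rewrite -subr_eq0 (negPf (sub_xi_neq0 _)).
pose p : {poly L} := 'X^#|F| - 'X.
have sp : size p = #|F|.+1.
  by rewrite size_polyDl ?size_polyXn // size_polyN size_polyX ltnS finRing_gt1.
have p0 : p != 0 by rewrite -size_poly_eq0 sp.
have roots_g : all (root p) [seq g t | t : option F].
  apply/allP => _ /mapP[[x|] _ ->]; rewrite rootE !hornerE /=.
    by rewrite frobenius_iota subrr.
  by rewrite -/xiq E subrr.
have := max_poly_roots p0 roots_g.
by rewrite map_inj_uniq // enum_uniq size_map -cardE card_option sp ltnn => /(_ isT).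
Qed.

Lemma cayley_inj : injective (cayley iota xi).
Proof.
(* No finite point shares the value 1 with infinity, as that would give xi = xi^q. *)
have neq1 x : (iota x - xi) / (iota x - xiq) != 1.
  rewrite -subr_eq0 -(mulfV (sub_conj_neq0 x)) -mulrBl mulf_eq0 invr_eq0.
  rewrite (negPf (sub_conj_neq0 x)) orbF opprB addrC addrA subrK.
  by rewrite subr_eq0 conj_neq.
move=> [x|] [y|] //=; rewrite -/xiq => /eqP.
- rewrite eqr_div ?sub_conj_neq0 // => /eqP E.
  have : (xi - xiq) * (iota x - iota y) = 0.
    by rewrite -[RHS](subrr ((iota y - xi) * (iota x - xiq))) -{1}E; ring.
  move/eqP; rewrite mulf_eq0 subr_eq0 eq_sym (negPf conj_neq) /= subr_eq0.
  by move/eqP/fmorph_inj ->.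
- by rewrite (negPf (neq1 _)).
- by rewrite eq_sym (negPf (neq1 _)).
Qed.

Lemma cayley_circle t : cayley iota xi t \in unit_circle F L.
Proof.
rewrite inE; case: t => [x|] /=; last by rewrite oner_eq0 expr1n eqxx.
rewrite -/xiq mulf_neq0 ?invr_eq0 ?sub_conj_neq0 ?sub_xi_neq0 //=.
(* Frobenius swaps xi and xi^q, so the q-th power of the quotient is its inverse. *)
rewrite addn1 exprS expr_div_n !frobeniusB frobenius_iota conjK.
by rewrite mulrACA -invfM [X in _ / X]mulrC mulfV // mulf_neq0 ?sub_conj_neq0 ?sub_xi_neq0.
Qed.

Lemma card_circle_le : (#|unit_circle F L| <= #|F| + 1)%N.
Proof.
rewrite cardE; apply: max_unity_roots; rewrite ?addn1 ?enum_uniq //.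
apply/allP => u; rewrite mem_enum inE => /andP[_ /eqP u1].
by apply/unity_rootP; rewrite -addn1.
Qed.

Lemma cayley_image : cayley iota xi @: [set: option F] = unit_circle F L.
Proof.
apply/eqP; rewrite eqEcard card_imset; last exact: cayley_inj.
rewrite cardsT card_option -addn1 card_circle_le andbT.
by apply/subsetP => _ /imsetP[t _ ->]; apply: cayley_circle.
Qed.

Lemma cayley_subset_image (T : {set L}) : T \subset unit_circle F L ->
  exists S : {set option F}, T = cayley iota xi @: S.
Proof.
move=> sT; exists (cayley iota xi @^-1: T); apply/setP => u.
apply/idP/imsetP => [uT|[t + ->]]; last by rewrite inE.
have : u \in unit_circle F L by apply: (subsetP sT).
by rewrite -cayley_image => /imsetP[t _ Eu]; exists t; rewrite // inE -Eu.
Qed.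

Lemma cayley_subst_form (S : {set option F}) : exists2 c : L, c != 0 &
  cayley_subst iota xi (form_of_set S) = c *: circle_form (cayley iota xi @: S).
Proof.
rewrite /circle_form big_imset /=; last by move=> ? ? _ _; apply: cayley_inj.
rewrite /cayley_subst /form_of_set rmorph_prod subst2_prod.
apply: prod_scaled => -[x|] /=; last first.
  exists 1; rewrite ?oner_eq0 // map_mpolyX subst2_X2.
  by rewrite !scale1r.
(* The scalar is the coefficient of U in (xi^q U - xi V) - x(U - V). *)
exists (xiq - iota x); first by rewrite -opprB oppr_eq0 sub_conj_neq0.
rewrite rmorphB /= map_mpolyZ !map_mpolyX subst2B subst2Z subst2_X1 subst2_X2.
rewrite -/xiq.
have E : (xiq - iota x) * ((iota x - xi) / (iota x - xiq)) = xi - iota x.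
  by rewrite -opprB mulNr mulrC divfK ?sub_conj_neq0 // opprB.
rewrite [RHS]scalerBr scalerA E -!mul_mpolyC !rmorphB /=; ring.
Qed.

(** The new arguments come from solving X = xi^q U - xi V, Y = U - V for U and V. Being able to undo
    the substitution lets it be cancelled from an equation. *)
Lemma subst_cayleyK (f : {mpoly L[2]}) :
  subst2 (subst2 f (xiq *: X1 - xi *: X2) (X1 - X2))
    ((xiq - xi)^-1 *: (X1 - xi *: X2)) ((xiq - xi)^-1 *: (X1 - xiq *: X2)) = f.
Proof.
have d0 : xiq - xi != 0 by rewrite subr_eq0 conj_neq.
rewrite subst2_comp !subst2B !subst2Z !subst2_X1 !subst2_X2 -[RHS]subst2_id.
by congr (subst2 f _ _); rewrite -[RHS]scale1r -(mulVf d0) -scalerA;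
   rewrite -!mul_mpolyC !rmorphB /=; ring.
Qed.

End Cayley.

Theorem proposition5 (q : nat) (F L : finFieldType) (iota : {rmorphism F -> L})
    (xi : L) (k : nat) (W : {pred {mpoly F[2]}})
    (hF : #|F| = q) (hL : #|L| = (q ^ 2)%N)
    (hxi : xi \notin codom iota)
    (hk : (k <= q + 1)%N)
    (hW : is_form_subspace k W)
    (hinv : gl2_invariant W) :
  (forall T : {set L},
     T \in cayley_blocks iota xi k W <->
     [/\ T \subset unit_circle F L, #|T| = k
       & in_transformed iota xi W (circle_form T)]) /\
  (blocks k W <> set0 ->
     exists lambda : nat,
       is_design 3 (q + 1) k lambda (unit_circle F L)
         (cayley_blocks iota xi k W)).
Proof.
subst q; have [W_sub _] := hW.
have k_inj : injective (cayley iota xi) by exact: cayley_inj.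
have sub_circle (S : {set option F}) : cayley iota xi @: S \subset unit_circle F L.
  by apply/subsetP => _ /imsetP[t _ ->]; apply: cayley_circle.
split=> [T|_].
  split=> [/imsetP[S + ->]|[T_sub cT [n [c [h [hW' E]]]]]].
    rewrite inE => /andP[/eqP cS SW]; split; rewrite ?card_imset //.
    have [c c0 E] := cayley_subst_form hL hxi S.
    exists 1%N, (fun _ => c^-1), (fun _ => cayley_subst iota xi (form_of_set S)).
    split; first by move=> _; exists (form_of_set S).
    by rewrite big_ord1 E scalerA mulVf // scale1r.
  have [S ET] := cayley_subset_image hL hxi T_sub; subst T.
  apply/imsetP; exists S => //; rewrite inE -(card_imset _ k_inj) cT eqxx /=.
  have [d d0 Ed] := cayley_subst_form hL hxi S.
  (* Choose preimages in [W] of all the spanning elements at once. *)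
  have [f fP] : exists f : 'I_n -> {mpoly F[2]},
      forall i, f i \in W /\ h i = cayley_subst iota xi (f i).
    apply: (@fin_all_exists _ (fun=> {mpoly F[2]})
      (fun i f => f \in W /\ h i = cayley_subst iota xi f)) => i.
    by have [f fW hf] := hW' i; exists f.
  (* The factor [d] appears because F_S is carried to [d] times G_T. *)
  apply: (span_descent (h := f) (c := fun i => d * c i) hL hxi W_sub).
    by move=> i; case: (fP i).
  rewrite -[LHS](subst_cayleyK hxi) -[RHS](subst_cayleyK hxi).
  congr (subst2 _ _ _); rewrite -/(cayley_subst iota xi _) Ed E subst2_sum.
  rewrite scaler_sumr; apply: eq_bigr => i _.
  by rewrite subst2Z -scalerA; case: (fP i) => _ ->.
(* The triple 0, 1, infinity is the reference to which every other triple is moved. *)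
pose lambda := #|[set S in blocks k W | [set Some 0; Some 1; None] \subset S]|.
exists lambda; split.
- rewrite -(cayley_image hL hxi) card_imset // cardsT card_option.
  by rewrite addn1.
- move=> _ /imsetP[S + ->]; rewrite inE => /andP[/eqP cS _].
  by rewrite card_imset.
move=> A /(cayley_subset_image hL hxi)[A' ->]; rewrite card_imset // => cA.
have [m m_blk mA] := block_perm_3transitive k W_sub hinv cA.
rewrite /lambda -mA -(card_blocks_above_perm _ m_blk).
(* Blocks on the circle above the image of A' are exactly the Cayley images of blocks above A'. *)
rewrite -[RHS](card_imset _ (imset_inj k_inj)); congr #|pred_of_set _|.
apply/setP => T; apply/setIdP/imsetP => [[/imsetP[S bS ->] AS]|[S + ->]].
  exists S => //; apply/setIdP; split=> //; apply/subsetP => x xA.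
  have /imsetP[y yS /k_inj -> //] : cayley iota xi x \in cayley iota xi @: S.
  by apply: (subsetP AS); apply: imset_f.
by move=> /setIdP[bS AS]; rewrite imsetS // imset_f.
Qed.
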